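(* Let $\mathcal{C}_{2k}(q)=(q)_\infty C_{2k}(q)$ for $k\ge1$, where $C_{2k}(q)$ is the $2k$-th crank moment generating function. Then the two families $\{\mathcal{C}_{2k}(q):k\ge1\}$ and $\{G_{2k}(\tau):k\ge1\}$ generate the same $\mathbb{Q}$-algebra, that is, $$\mathbb{Q}[\mathcal{C}_2,\mathcal{C}_4,\ldots]=\mathbb{Q}[G_2,G_4,\ldots].$$
   Context: Here $q=e^{2\pi i\tau}$ with $\mathrm{Im}(\tau)>0$, $(a)_\infty=\prod_{j\ge1}(1-aq^{j-1})$, in particular $(q)_\infty=\prod_{j\ge1}(1-q^j)$. The crank generating function is $$C(\zeta;q)=\sum_{m\in\mathbb{Z},\,n\ge0}M(m,n)\zeta^mq^n=\frac{(q)_\infty}{(\zeta q)_\infty(\zeta^{-1}q)_\infty},$$ where the crank counts $M(m,n)$ are the coefficients defined by this identity, and $$C_k(q)=\sum_{n\ge0}\sum_{m\in\mathbb{Z}}m^kM(m,n)q^n=\left.\left(\zeta\frac{d}{d\zeta}\right)^kC(\zeta;q)\right|_{\zeta=1}.$$ $B_n$ is the $n$-th Bernoulli number, $\sigma_j(n)=\sum_{d\mid n}d^j$, and $G_{2k}(\tau)=-\frac{B_{2k}}{4k}+\sum_{n\ge1}\sigma_{2k-1}(n)q^n$. Both algebras are the $\mathbb{Q}$-subalgebras generated by the indicated $q$-series. *)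

(* Defs.v *)
From HB Require Import structures.
From mathcomp Require Import all_boot all_order all_algebra finmap.
From mathcomp Require Import boolp classical_sets.
From mathcomp Require Import monalg.

Set Implicit Arguments.
Unset Strict Implicit.
Unset Printing Implicit Defensive.

Import GRing.Theory.

Local Open Scope ring_scope.

(* Formal power series in one variable q.  Every q-series below is taken as a
   formal power series. *)
Record fps (A : Type) := FPS { fcoef : nat -> A }.

Lemma fpsP (A : Type) (f g : fps A) :
  (forall n, fcoef f n = fcoef g n) -> f = g.
Proof. by case: f g => [f] [g] /= /funext ->. Qed.

HB.instance Definition _ (A : Type) := gen_eqMixin (fps A).
HB.instance Definition _ (A : Type) := gen_choiceMixin (fps A).

(* fps_mul, fps_inv, qpoch and laurent_mul are locked to keep unification from
   unfolding them. *)
HB.lock Definition fps_mul (A : comNzRingType) (f g : fps A) : fps A :=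
  FPS (fun n => \sum_(i < n.+1) fcoef f i * fcoef g (n - i)).

Section FpsRing.
Variable A : comNzRingType.
Implicit Types (f g h : fps A) (a b : A).

Definition fps_zero : fps A := FPS (fun=> 0).
Definition fps_opp f := FPS (fun n => - fcoef f n).
Definition fps_add f g := FPS (fun n => fcoef f n + fcoef g n).

Fact fps_addA : associative fps_add.
Proof. by move=> f g h; apply/fpsP => n /=; rewrite addrA. Qed.
Fact fps_addC : commutative fps_add.
Proof. by move=> f g; apply/fpsP => n /=; rewrite addrC. Qed.
Fact fps_add0 : left_id fps_zero fps_add.
Proof. by move=> f; apply/fpsP => n /=; rewrite add0r. Qed.
Fact fps_addN : left_inverse fps_zero fps_opp fps_add.
Proof. by move=> f; apply/fpsP => n /=; rewrite addNr. Qed.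

HB.instance Definition _ := GRing.isZmodule.Build (fps A)
  fps_addA fps_addC fps_add0 fps_addN.

Definition fps_const a : fps A := FPS (fun n => if n == 0%N then a else 0).

Lemma fcoef_mul f g n :
  fcoef (fps_mul f g) n = \sum_(i < n.+1) fcoef f i * fcoef g (n - i).
Proof. by rewrite fps_mul.unlock. Qed.

Let trunc N f : {poly A} := \poly_(i < N) fcoef f i.

Let trunc_mul N n f g :
  (n < N)%N -> fcoef (fps_mul f g) n = (trunc N f * trunc N g)`_n.
Proof.
move=> ltnN; rewrite coefM fcoef_mul; apply: eq_bigr => i _.
by rewrite !coef_poly (leq_ltn_trans (leq_subr _ _) ltnN)
  (leq_ltn_trans _ ltnN) // -ltnS.
Qed.

Fact fps_mulC : commutative (@fps_mul A).
Proof.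
by move=> f g; apply/fpsP => n; rewrite !(trunc_mul _ _ (ltnSn n)) mulrC.
Qed.

Fact fps_mulA : associative (@fps_mul A).
Proof.
move=> f g h; apply/fpsP => n.
have T k : (k <= n)%N -> (k < n.+1)%N by [].
transitivity ((trunc n.+1 f * (trunc n.+1 g * trunc n.+1 h))`_n).
  rewrite coefM fcoef_mul; apply: eq_bigr => i _.
  by rewrite -(trunc_mul _ _ (T _ (leq_subr i n))) coef_poly ltn_ord.
rewrite mulrA coefM fcoef_mul; apply: eq_bigr => i _.
by rewrite -(trunc_mul _ _ (ltn_ord i)) coef_poly (T _ (leq_subr i n)).
Qed.

Fact fps_mul1 : left_id (fps_const 1) (@fps_mul A).
Proof.
move=> f; apply/fpsP => n.
rewrite fcoef_mul big_ord_recl mul1r subn0 big1 ?addr0 //.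
by move=> i _; rewrite mul0r.
Qed.

Fact fps_mulDl : left_distributive (@fps_mul A) fps_add.
Proof.
move=> f g h; apply/fpsP => n.
rewrite [RHS]/= !fcoef_mul -big_split /=.
by apply: eq_bigr => i _; rewrite mulrDl.
Qed.

Fact fps_one_neq0 : fps_const 1 != 0.
Proof.
by apply/eqP => /(congr1 (fun f => fcoef f 0%N)) /= /eqP; rewrite oner_eq0.
Qed.

HB.instance Definition _ := GRing.Zmodule_isComNzRing.Build (fps A)
  fps_mulA fps_mulC fps_mul1 fps_mulDl fps_one_neq0.

Lemma fcoefM f g n :
  fcoef (f * g) n = \sum_(i < n.+1) fcoef f i * fcoef g (n - i).
Proof. exact: fcoef_mul. Qed.

Definition fps_scale a f : fps A := FPS (fun n => a * fcoef f n).

Fact fps_scaleA a b f : fps_scale a (fps_scale b f) = fps_scale (a * b) f.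
Proof. by apply/fpsP => n /=; rewrite mulrA. Qed.
Fact fps_scale1 : left_id 1 fps_scale.
Proof. by move=> f; apply/fpsP => n /=; rewrite mul1r. Qed.
Fact fps_scaleDr : right_distributive fps_scale +%R.
Proof. by move=> a f g; apply/fpsP => n /=; rewrite mulrDr. Qed.
Fact fps_scaleDl f : {morph fps_scale^~ f : a b / a + b}.
Proof. by move=> a b; apply/fpsP => n /=; rewrite mulrDl. Qed.

HB.instance Definition _ := GRing.Zmodule_isLmodule.Build A (fps A)
  fps_scaleA fps_scale1 fps_scaleDr fps_scaleDl.

Fact fps_scaleAl a f g : a *: (f * g) = a *: f * g.
Proof.
apply/fpsP => n; rewrite [LHS]/= !fcoefM mulr_sumr.
by apply: eq_bigr => i _; rewrite mulrA.
Qed.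

HB.instance Definition _ := GRing.Lmodule_isLalgebra.Build A (fps A)
  fps_scaleAl.
HB.instance Definition _ := GRing.Lalgebra_isComAlgebra.Build A (fps A).

End FpsRing.

HB.lock Definition fps_inv (A : comNzRingType) (f : fps A) : fps A :=
  xget f [set g | g * f = 1]%classic.

Section FpsUnitRing.
Variable A : comNzRingType.
Implicit Types (f g : fps A).

Definition fps_unit : pred (fps A) := fun f => `[< exists g, g * f = 1 >].

Fact fps_mulVr : {in fps_unit, left_inverse 1 (@fps_inv A) *%R}.
Proof.
move=> f /asboolP [g gf1]; rewrite fps_inv.unlock.
by case: xgetP => [h _ //|/(_ g)]; case.
Qed.
Fact fps_unitP f g : g * f = 1 -> fps_unit f.
Proof. by move=> gf1; apply/asboolP; exists g. Qed.
Fact fps_invr_out : {in [predC fps_unit], @fps_inv A =1 id}.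
Proof.
move=> f /asboolPn nf; rewrite fps_inv.unlock; case: xgetP => // g _ gf1.
by case: nf; exists g.
Qed.

HB.instance Definition _ := GRing.ComNzRing_hasMulInverse.Build (fps A)
  fps_mulVr fps_unitP fps_invr_out.

Fixpoint fps_inv_seq f n : seq A :=
  if n is m.+1 then
    let s := fps_inv_seq f m in
    rcons s ((m == 0%N)%:R - \sum_(i < m) s`_i * fcoef f (m - i))
  else [::].

Lemma fps_coef0_unit f : fcoef f 0 = 1 -> f \is a GRing.unit.
Proof.
move=> f0; pose s := fps_inv_seq f.
have ss n : size (s n) = n by elim: n => //= n IHn; rewrite size_rcons IHn.
have sE n N : (n < N)%N -> (s N)`_n = (s n.+1)`_n.
  elim: N => // N IHN; rewrite ltnS leq_eqVlt => /predU1P [-> //|ltnN].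
  by rewrite /= nth_rcons ss ltnN IHN.
apply: (@fps_unitP f (FPS (fun n => (s n.+1)`_n))).
apply/fpsP => n; rewrite fcoefM big_ord_recr /= subnn f0 mulr1 nth_rcons ss.
rewrite ltnn eqxx.
rewrite addrC -[LHS]addrA [X in _ + X](_ : _ = 0) ?addr0; first by case: n.
apply/eqP; rewrite addrC subr_eq0; apply/eqP; apply: eq_bigr => i _.
by rewrite -(sE i n).
Qed.

Definition fps_X : fps A := FPS (fun n => (n == 1%N)%:R).

End FpsUnitRing.

(* The product of 1 - a q^(j-1) over j >= 1: the factors with j - 1 > n do not
   contribute to the coefficient of q^n (see fcoef_qpoch). *)
HB.lock Definition qpoch (A : comNzRingType) (a : fps A) : fps A :=
  FPS (fun n => fcoef (\prod_(1 <= j < n.+2) (1 - a * fps_X A ^+ j.-1)) n).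

Section QPochhammer.
Variable A : comNzRingType.
Implicit Types (f : fps A).
Local Notation fps_X := (fps_X A).

Lemma fcoef_XnM n m f :
  fcoef (fps_X ^+ m * f) n = if (n < m)%N then 0 else fcoef f (n - m).
Proof.
elim: m n => [|m IHm] n; first by rewrite mul1r ltn0 subn0.
rewrite exprS -mulrA; case: n => [|n]; first by rewrite fcoefM big_ord1 mul0r.
rewrite ltnS subSS -IHm; move: (fps_X ^+ m * f) => g.
rewrite fcoefM 2!big_ord_recl /= mul0r add0r mul1r big1 ?addr0 ?subn1 //.
by move=> i _; rewrite mul0r.
Qed.

Lemma fcoef_qpoch f n N : (n < N)%N ->
  fcoef (qpoch f) n = fcoef (\prod_(1 <= j < N.+1) (1 - f * fps_X ^+ j.-1)) n.
Proof.
elim: N => // N IHN; rewrite ltnS leq_eqVlt => /predU1P [->|ltnN].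
  by rewrite qpoch.unlock.
rewrite (IHN ltnN); set F := fun j => 1 - f * fps_X ^+ j.-1.
have -> : \prod_(1 <= j < N.+2) F j = \prod_(1 <= j < N.+1) F j * F N.+1.
  by rewrite big_nat_recr.
move: (\prod_(_ <= _ < _) _) => p; rewrite /F.
rewrite mulrBr mulr1 mulrA [X in p - X]mulrC -[LHS]subr0.
by rewrite -[in LHS](_ : fcoef (fps_X ^+ N * (p * f)) n = 0) // fcoef_XnM ltnN.
Qed.

End QPochhammer.

(* Laurent polynomials in zeta, with a@_m the coefficient of zeta^m.  The
   library equips {malg R[K]} with a product only for monoids K without
   nontrivial units, which excludes K = int under addition. *)
Definition laurent (R : comNzRingType) := {malg R[int]}.

HB.lock Definition laurent_mul (R : comNzRingType) (f g : laurent R) :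
    laurent R :=
  \sum_(i <- msupp f) \sum_(j <- msupp g) << f@_i * g@_j *g (i + j)%R >>.

Section Laurent.
Variable R : comNzRingType.
Implicit Types (f g h : laurent R).

HB.instance Definition _ := GRing.Lmodule.on (laurent R).

Definition zeta_pow (m : int) : laurent R := << (1 : R) *g m >>.

Let mulw (d e : {fset int}) f g : (msupp f `<=` d)%fset ->
  (msupp g `<=` e)%fset -> laurent_mul f g =
  \sum_(i <- d) \sum_(j <- e) << f@_i * g@_j *g (i + j)%R >>.
Proof.
move=> fd ge; rewrite laurent_mul.unlock (big_fset_incl _ fd) /=.
  apply/eq_bigr => i _; apply/big_fset_incl => // j _ /mcoeff_outdom ->.
  by rewrite mulr0 monalgU0.
move=> i _ /mcoeff_outdom fi.
by rewrite big1 => // j _; rewrite fi mul0r monalgU0.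
Qed.

Fact laurent_mulC : commutative (@laurent_mul R).
Proof.
move=> f g; rewrite laurent_mul.unlock exchange_big /=; apply: eq_bigr => j _.
by apply: eq_bigr => i _; rewrite mulrC addrC.
Qed.

Fact laurent_mulDl : left_distributive (@laurent_mul R) +%R.
Proof.
move=> f g h.
rewrite (mulw (msuppD_le f g) (fsubset_refl _)).
rewrite [X in _ = X + _](mulw (fsubsetUl _ (msupp g)) (fsubset_refl _)).
rewrite [X in _ = _ + X](mulw (fsubsetUr (msupp f) _) (fsubset_refl _)).
rewrite -big_split /=; apply/eq_bigr => i _.
rewrite -big_split /=; apply/eq_bigr => j _.
by rewrite mcoeffD mulrDl monalgUD.
Qed.

Let mul0 : left_zero 0 (@laurent_mul R).
Proof. by move=> f; rewrite laurent_mul.unlock msupp0 big_seq_fset0. Qed.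

Let mulUU a b (i j : int) :
  laurent_mul (<< a *g i >> : laurent R) << b *g j >> =
  << a * b *g (i + j)%R >>.
Proof. by rewrite (mulw msuppU_le msuppU_le) !big_seq_fset1 !mcoeffUU. Qed.

Let mul_suml (I : Type) (s : seq I) (F : I -> laurent R) g :
  laurent_mul (\sum_(i <- s) F i) g = \sum_(i <- s) laurent_mul (F i) g.
Proof.
elim: s => [|i s IHs]; first by rewrite !big_nil mul0.
by rewrite !big_cons laurent_mulDl IHs.
Qed.

Let mul_sumr (I : Type) (s : seq I) (F : I -> laurent R) g :
  laurent_mul g (\sum_(i <- s) F i) = \sum_(i <- s) laurent_mul g (F i).
Proof.
by rewrite laurent_mulC mul_suml; apply: eq_bigr => i _; rewrite laurent_mulC.
Qed.

Let mulUA a b c (i j k : int) :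
  laurent_mul (<< a *g i >> : laurent R)
    (laurent_mul (<< b *g j >> : laurent R) << c *g k >>) =
  laurent_mul (laurent_mul (<< a *g i >> : laurent R) << b *g j >>) << c *g k >>.
Proof. by rewrite !mulUU mulrA addrA. Qed.

Fact laurent_mulA : associative (@laurent_mul R).
Proof.
move=> f g h; rewrite [f]monalgE.
do 3 rewrite [laurent_mul (\sum_(i <- msupp f) _) _]mul_suml.
apply: eq_bigr => i _; rewrite [g]monalgE.
rewrite [laurent_mul (\sum_(j <- msupp g) _) _]mul_suml.
rewrite 2![laurent_mul _ (\sum_(j <- msupp g) _)]mul_sumr.
rewrite [laurent_mul (\sum_(j <- msupp g) _) _]mul_suml.
apply: eq_bigr => j _; rewrite [h]monalgE.
do 3 rewrite [laurent_mul _ (\sum_(k <- msupp h) _)]mul_sumr.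
by apply: eq_bigr => k _.
Qed.

Fact laurent_mul1 : left_id (zeta_pow 0) (@laurent_mul R).
Proof.
move=> f; rewrite [f]monalgE mul_sumr; apply: eq_bigr => i _.
by rewrite mulUU mul1r add0r.
Qed.

Fact laurent_one_neq0 : zeta_pow 0 != 0.
Proof. by rewrite monalgU_eq0 oner_eq0. Qed.

HB.instance Definition _ := GRing.Zmodule_isComNzRing.Build (laurent R)
  laurent_mulA laurent_mulC laurent_mul1 laurent_mulDl laurent_one_neq0.

End Laurent.

Arguments zeta_pow {R} m.

Definition euler_q : fps rat := qpoch (fps_X rat).

Definition crank_gf : fps (laurent rat) :=
  let q := fps_X (laurent rat) in
  qpoch q / (qpoch (fps_const (zeta_pow 1) * q) *
             qpoch (fps_const (zeta_pow (-1)) * q)).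

Definition crank_count (m : int) (n : nat) : rat := (fcoef crank_gf n)@_m.

(* The sum over all m in Z, reduced to the finitely many m with
   crank_count m n != 0. *)
Definition crank_moment (k : nat) : fps rat :=
  FPS (fun n => \sum_(m <- msupp (fcoef crank_gf n))
                   m%:~R ^+ k * crank_count m n).

Definition normalized_crank_moment (k : nat) : fps rat :=
  euler_q * crank_moment k.

(* B_n / n! is the coefficient of t^n in t / (e^t - 1), that is, in the inverse
   of the sum of t^i / (i+1)!. *)
Definition bernoulli (n : nat) : rat :=
  (n`!)%:R * fcoef (FPS (fun i => ((i.+1)`!%:R : rat)^-1))^-1 n.

Definition sigma (j n : nat) : nat := (\sum_(d <- divisors n) d ^ j)%N.

(* The q-expansion of G_{2k}. *)
Definition eisenstein (k : nat) : fps rat :=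
  FPS (fun n => if n == 0%N then - bernoulli (2 * k) / (4 * k)%:R
                else (sigma (2 * k).-1 n)%:R).

Definition generated_subalg (R : nzRingType) (A : lalgType R) (S : set A) :
  set A :=
  [set x | forall B : set A,
     GRing.subalg_closed (mem B) -> (S `<=` B)%classic -> B x]%classic.

(* Main.v *)
(* Let theta = zeta d/dzeta.  The logarithmic derivative of the product C is
   L = sum over n >= 1 and d | n of (zeta^d - zeta^-d) q^n.  Applying theta^m to
   theta C = C L, setting zeta = 1 and multiplying by (q)_oo gives
     c_(m+1) = sum_(i <= m) binomial(m, i) c_i l_(m-i),   c_0 = 1,
   where c_k is the normalized k-th crank moment and l_k is theta^k L at
   zeta = 1, which is 0 for k even and twice G_(k+1) without its constant term
   for k odd.  As l_m enters with coefficient c_0 = 1, the recurrence can be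
   solved either way: each family is polynomial in the other. *)
Require Import Defs.
From HB Require Import structures.
From mathcomp Require Import all_boot all_order all_algebra finmap.
From mathcomp Require Import boolp classical_sets.
From mathcomp Require Import monalg.

Set Implicit Arguments.
Unset Strict Implicit.
Unset Printing Implicit Defensive.

Import GRing.Theory.

Local Open Scope classical_set_scope.
Local Open Scope ring_scope.

(** * Theta and the moments at zeta = 1 on Laurent polynomials *)

Section LaurentOperators.
Variable R : comNzRingType.
Implicit Types (f g : laurent R) (m : int) (k : nat).

Lemma laurent_ind (P : laurent R -> Prop) :
  P 0 -> (forall a m, P << a *g m >>) ->
  (forall f g, P f -> P g -> P (f + g)) -> forall f, P f.
Proof. by move=> P0 PU PD f; rewrite [f]monalgE; elim/big_ind: _. Qed.

(** Additivity forces [F m 0 = 0], so each sum may run over any finite set containing the support;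
    the union of the supports of [f] and [g] serves for all three sums. *)
Lemma msupp_sum_is_zmod_morphism (V : zmodType) (F : int -> R -> V) :
  (forall m, zmod_morphism (F m)) ->
  zmod_morphism (fun f : laurent R => \sum_(m <- msupp f) F m f@_m).
Proof.
move=> FB; have F0 m : F m 0 = 0 by rewrite -[X in F m X](subr0 0) FB subrr.
have wide f (d : {fset int}) : (msupp f `<=` d)%fset ->
    \sum_(m <- msupp f) F m f@_m = \sum_(m <- d) F m f@_m.
  move=> fd; apply: big_fset_incl => // m _ /mcoeff_outdom ->.
  exact: F0.
move=> f g; rewrite (wide _ _ (msuppB_le f g)).
rewrite (wide _ _ (fsubsetUl (msupp f) (msupp g))).
rewrite (wide _ _ (fsubsetUr (msupp f) (msupp g))) -sumrB.
by apply: eq_bigr => m _; rewrite mcoeffB FB.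
Qed.

Lemma laurent_mulUU (a b : R) (i j : int) :
  (<< a *g i >> : laurent R) * << b *g j >> = << a * b *g (i + j)%R >>.
Proof.
have E : laurent_mul (<< a *g i >> : laurent R) << b *g j >> =
         << a * b *g (i + j)%R >>.
  rewrite laurent_mul.unlock !msuppU.
  (* A monomial with zero coefficient has empty support, so these cases are split off. *)
  case: eqP => [->|_]; first by rewrite big_seq_fset0 mul0r monalgU0.
  case: eqP => [->|_].
    by rewrite big_seq_fset1 big_seq_fset0 mulr0 monalgU0.
  by rewrite !big_seq_fset1 !mcoeffUU.
exact: E.
Qed.

Definition laurent_theta f : laurent R :=
  \sum_(m <- msupp f) << m%:~R * f@_m *g m >>.

Fact laurent_theta_is_zmod_morphism : zmod_morphism laurent_theta.
Proof.
apply: (@msupp_sum_is_zmod_morphism _ (fun m a => << m%:~R * a *g m >>)).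
by move=> m a b; rewrite mulrBr monalgUB.
Qed.

HB.instance Definition _ :=
  GRing.isZmodMorphism.Build (laurent R) (laurent R) laurent_theta
    laurent_theta_is_zmod_morphism.

(** This is theta^k f at zeta = 1. Since [0 ^+ 0 = 1], the case k = 0 is plain evaluation at zeta =
    1. *)
Definition laurent_moment k f : R := \sum_(m <- msupp f) m%:~R ^+ k * f@_m.

Fact laurent_moment_is_zmod_morphism k : zmod_morphism (laurent_moment k).
Proof. exact: msupp_sum_is_zmod_morphism (fun m => mulrBr (m%:~R ^+ k)). Qed.

HB.instance Definition _ k :=
  GRing.isZmodMorphism.Build (laurent R) R (laurent_moment k)
    (@laurent_moment_is_zmod_morphism k).

Lemma laurent_thetaU (a : R) m :
  laurent_theta << a *g m >> = << m%:~R * a *g m >>.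
Proof.
rewrite /laurent_theta msuppU; case: eqP => [->|_].
  by rewrite big_seq_fset0 mulr0 monalgU0.
by rewrite big_seq_fset1 mcoeffUU.
Qed.

Lemma laurent_momentU k (a : R) m :
  laurent_moment k << a *g m >> = m%:~R ^+ k * a.
Proof.
rewrite /laurent_moment msuppU; case: eqP => [->|_].
  by rewrite big_seq_fset0 mulr0.
by rewrite big_seq_fset1 mcoeffUU.
Qed.

Lemma laurent_thetaM f g :
  laurent_theta (f * g) = laurent_theta f * g + f * laurent_theta g.
Proof.
elim/laurent_ind: f => [|a i|f f' IHf IHf'].
- by rewrite raddf0 !mul0r raddf0 addr0.
- elim/laurent_ind: g => [|b j|g g' IHg IHg'].
  + by rewrite raddf0 !mulr0 raddf0 addr0.
  + rewrite laurent_mulUU !laurent_thetaU !laurent_mulUU -monalgUD.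
    by rewrite rmorphD mulrDl mulrA [a * (_ * b)]mulrCA.
  + by rewrite mulrDr !raddfD /= IHg IHg' !mulrDr addrACA.
- by rewrite mulrDl !raddfD /= IHf IHf' !mulrDl addrACA.
Qed.

(** Leibniz rule for theta^k at zeta = 1. By biadditivity it reduces to monomials, where it is the
    binomial expansion of (m + n)^k. *)
Lemma laurent_momentM k f g :
  laurent_moment k (f * g) =
  \sum_(i < k.+1)
     laurent_moment i f * laurent_moment (k - i) g *+ 'C(k, i).
Proof.
elim/laurent_ind: f => [|a m|f f' IHf IHf'].
- rewrite mul0r raddf0 big1 // => i _.
  by rewrite raddf0 mul0r mul0rn.
- elim/laurent_ind: g => [|b n|g g' IHg IHg'].
  + rewrite mulr0 raddf0 big1 // => i _.
    by rewrite raddf0 mulr0 mul0rn.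
  + rewrite laurent_mulUU laurent_momentU rmorphD /= addrC exprDn mulr_suml.
    apply: eq_bigr => i _; rewrite !laurent_momentU mulrnAl; congr (_ *+ _).
    by rewrite [_ * m%:~R ^+ _]mulrC mulrACA.
  + rewrite mulrDr raddfD /= IHg IHg' -big_split; apply: eq_bigr => i _ /=.
    by rewrite raddfD mulrDr mulrnDl.
- rewrite mulrDl raddfD /= IHf IHf' -big_split; apply: eq_bigr => i _ /=.
  by rewrite raddfD mulrDl mulrnDl.
Qed.

Lemma laurent_moment_theta k f :
  laurent_moment k (laurent_theta f) = laurent_moment k.+1 f.
Proof.
elim/laurent_ind: f => [|a m|f g IHf IHg]; first by rewrite !raddf0.
  by rewrite laurent_thetaU !laurent_momentU mulrA exprSr.
by rewrite !raddfD /= IHf IHg.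
Qed.

End LaurentOperators.

(** * Coefficientwise extension to power series in q *)

Section FpsMap.
Variables A B : comNzRingType.
Implicit Types (h : {additive A -> B}) (f g : fps A).

Definition fps_map (h : A -> B) f : fps B := FPS (fun n => h (fcoef f n)).

Fact fps_map_is_zmod_morphism h : zmod_morphism (fps_map h).
Proof. by move=> f g; apply/fpsP => n /=; rewrite raddfB. Qed.

HB.instance Definition _ h :=
  GRing.isZmodMorphism.Build (fps A) (fps B) (fps_map h)
    (fps_map_is_zmod_morphism h).

End FpsMap.

Section Fcoef.
Variable A : comNzRingType.

Lemma fcoef_sum I (s : seq I) (P : pred I) (F : I -> fps A) n :
  fcoef (\sum_(i <- s | P i) F i) n = \sum_(i <- s | P i) fcoef (F i) n.
Proof. by elim/big_rec2: _ => // i x f _ <-. Qed.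

Lemma fcoefMn (f : fps A) k n : fcoef (f *+ k) n = fcoef f n *+ k.
Proof. by elim: k => // k IHk; rewrite !mulrS -IHk. Qed.

Lemma fcoef_constM a (f : fps A) n : fcoef (fps_const a * f) n = a * fcoef f n.
Proof.
rewrite fcoefM big_ord_recl subn0 big1 ?addr0 // => i _.
by rewrite /= mul0r.
Qed.

Lemma fcoef_Xn m n : fcoef (fps_X A ^+ m) n = (n == m)%:R.
Proof.
rewrite -[fps_X A ^+ m]mulr1 fcoef_XnM ltnNge /= subn_eq0.
by case: ltngtP.
Qed.

Lemma fcoef_qpoch0 (f : fps A) : fcoef f 0 = 0 -> fcoef (qpoch f) 0 = 1.
Proof.
move=> f0; rewrite (@fcoef_qpoch _ _ 0 1) // big_nat1 /= expr0 mulr1.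
by rewrite f0 subr0.
Qed.

End Fcoef.

Section QseriesOperators.
Variable R : comNzRingType.
Implicit Types (f g : fps (laurent R)) (e : int) (k : nat).

Definition theta : fps (laurent R) -> fps (laurent R) :=
  fps_map (@laurent_theta R).
Definition moment k : fps (laurent R) -> fps R := fps_map (laurent_moment k).

HB.instance Definition _ := GRing.Additive.on theta.
HB.instance Definition _ k := GRing.Additive.on (moment k).

Lemma thetaM f g : theta (f * g) = theta f * g + f * theta g.
Proof.
apply/fpsP => n /=; rewrite !fcoefM raddf_sum -big_split /=.
by apply: eq_bigr => i _; rewrite laurent_thetaM.
Qed.

Lemma theta1 : theta 1 = 0.
Proof.
apply/fpsP => n /=.
by case: eqP => _; rewrite ?raddf0 // laurent_thetaU mul0r monalgU0.
Qed.

Lemma momentM k f g :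
  moment k (f * g) = \sum_(i < k.+1) moment i f * moment (k - i) g *+ 'C(k, i).
Proof.
apply/fpsP => n /=; rewrite fcoefM raddf_sum fcoef_sum /=.
under eq_bigr => i _ do rewrite laurent_momentM.
rewrite exchange_big /=; apply: eq_bigr => i _.
by rewrite fcoefMn fcoefM sumrMnl.
Qed.

Lemma moment_theta k f : moment k (theta f) = moment k.+1 f.
Proof. by apply/fpsP => n; apply: laurent_moment_theta. Qed.

(** Logarithmic derivatives add over products. Writing [F j * G j] for the derivative of [F j]
    avoids dividing by the factors. *)
Lemma theta_prod (F G : nat -> fps (laurent R)) m n :
  (forall j, (m <= j < n)%N -> theta (F j) = F j * G j) ->
  theta (\prod_(m <= j < n) F j) =
  \prod_(m <= j < n) F j * \sum_(m <= j < n) G j.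
Proof.
elim: n => [|n IHn] FG.
  by rewrite !big_geq // mulr0 theta1.
case: (leqP m n) => [lemn|ltnm].
  rewrite !big_nat_recr //= thetaM IHn => [|j /andP [? /ltnW ?]].
    by rewrite FG ?lemn ?leqnn // mulrDr mulrAC mulrA.
  by apply: FG; apply/andP.
by rewrite !big_geq // mulr0 theta1.
Qed.

End QseriesOperators.

(** * Logarithmic derivatives of the q-Pochhammer products *)

Section CrankLogarithmicDerivative.
Variable R : comNzRingType.
Implicit Types (e : int) (j k n : nat).
Local Notation X := (fps_X (laurent R)).

Lemma laurent_theta_zeta (m : int) :
  laurent_theta (zeta_pow m : laurent R) = zeta_pow m *~ m.
Proof.
rewrite laurent_thetaU mulr1; apply/malgP => i.
rewrite (raddfMz (mcoeff i)) /= !mcoeffU.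
by case: eqP => _; rewrite ?mulr1n // !mulr0n mul0rz.
Qed.

Lemma zeta_powD (m n : int) :
  zeta_pow (m + n) = zeta_pow m * zeta_pow n :> laurent R.
Proof. by rewrite laurent_mulUU mulr1. Qed.

(* The logarithmic derivative -e z q^j / (1 - z q^j) of 1 - z q^j, where
   z = zeta^e, expanded as a geometric series. *)
Definition dlog_factor e j : fps (laurent R) :=
  FPS (fun n => if (0 < n)%N && (j %| n)%N
                then zeta_pow (e * (n %/ j)%:Z) *~ - e else 0).

(* The sum of the previous series over all j >= 1: those with j > n + 1 do not
   contribute to the coefficient of q^n. *)
Definition dlog_qpoch e : fps (laurent R) :=
  FPS (fun n => fcoef (\sum_(1 <= j < n.+2) dlog_factor e j) n).

Lemma fcoef_dlog_qpoch e n N : (n < N)%N ->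
  fcoef (dlog_qpoch e) n = fcoef (\sum_(1 <= j < N.+1) dlog_factor e j) n.
Proof.
elim: N => // N IHN; rewrite ltnS leq_eqVlt => /predU1P [-> //|ltnN].
rewrite (IHN ltnN) !fcoef_sum [in RHS]big_nat_recr //=.
case: n ltnN {IHN} => [|n] ltnN /=; first by rewrite addr0.
by rewrite gtnNdvd ?addr0 // (ltn_trans ltnN).
Qed.

(** Multiplying the geometric series by 1 - zeta^e q^j makes it telescope: the coefficients at
    multiples n > j cancel in pairs and only n = j survives. *)
Lemma dlog_factorE e j : (0 < j)%N ->
  (1 - fps_const (zeta_pow e) * X ^+ j) * dlog_factor e j =
  theta (1 - fps_const (zeta_pow e) * X ^+ j).
Proof.
move=> j0; rewrite (raddfB (@theta R)) /= theta1 sub0r; apply/fpsP => n.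
rewrite mulrBl mul1r -mulrA [LHS]/= [RHS]/= !fcoef_constM fcoef_Xn fcoef_XnM /=.
case: (ltngtP n j) => [ltnj|ltjn|->].
- rewrite !mulr0 subr0 raddf0 oppr0.
  by case: posnP => //= n0; rewrite gtnNdvd.
- rewrite subn_gt0 ltjn (leq_ltn_trans _ ltjn) //= mulr0 raddf0 oppr0.
  have -> : (j %| n - j)%N = (j %| n)%N by rewrite dvdn_subl ?(ltnW ltjn).
  have [/dvdnP [d dE]|_] := boolP (j %| n)%N.
    have d0 : (0 < d)%N by case: d dE ltjn => // ->.
    rewrite dE -[X in (_ - X)%N]mul1n -mulnBl !mulnK // mulrzAr -zeta_powD.
    by rewrite -{3}[e]mulr1 -mulrDr -PoszD subnKC // subrr.
  by rewrite mulr0 subr0.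
- rewrite j0 dvdnn divnn j0 subnn ltnn mulr0 subr0 !mulr1.
  by rewrite laurent_theta_zeta mulrNz.
Qed.

Lemma theta_qpoch e :
  theta (qpoch (fps_const (zeta_pow e) * X)) =
  qpoch (fps_const (zeta_pow e) * X) * dlog_qpoch e.
Proof.
set F := fun j => 1 - fps_const (zeta_pow e) * X * X ^+ j.-1.
have dF j N : (1 <= j < N)%N -> theta (F j) = F j * dlog_factor e j.
  by case/andP=> j0 _; rewrite /F -mulrA -exprS prednK // dlog_factorE.
apply/fpsP => n.
(* The first n + 1 factors determine the coefficients of q^i for all i <= n, so one finite product
   serves the whole convolution. *)
rewrite [LHS]/= (@fcoef_qpoch _ _ n n.+1) //.
have := congr1 (fun f => fcoef f n) (theta_prod (@dF ^~ n.+2)).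
rewrite {1}/theta {1}/fps_map /= => ->.
rewrite !fcoefM; apply: eq_bigr => i _.
rewrite (@fcoef_qpoch _ _ i n.+1) ?ltn_ord // (@fcoef_dlog_qpoch _ _ n.+1) //.
by rewrite ltnS leq_subr.
Qed.

End CrankLogarithmicDerivative.

(** * Specialization at zeta = 1, a ring morphism *)

Section MomentZero.
Variable R : comNzRingType.

Lemma moment0M : {morph @moment R 0 : f g / f * g}.
Proof. by move=> f g; rewrite momentM big_ord1. Qed.

Lemma moment0_const_zeta (m : int) :
  @moment R 0 (fps_const (zeta_pow m)) = 1.
Proof.
apply/fpsP => n /=.
by case: eqP => _; rewrite ?raddf0 // laurent_momentU expr0 mul1r.
Qed.

Lemma moment0_1 : @moment R 0 1 = 1.
Proof. exact: moment0_const_zeta 0. Qed.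

Lemma moment0_X : @moment R 0 (fps_X (laurent R)) = fps_X R.
Proof.
apply/fpsP => n /=.
by case: eqP => _; rewrite ?raddf0 // laurent_momentU expr0 mul1r.
Qed.

Lemma moment0_qpoch f : @moment R 0 (qpoch f) = qpoch (moment 0 f).
Proof.
apply/fpsP => n; rewrite [LHS]/= !(@fcoef_qpoch _ _ n n.+1) //.
rewrite -[LHS]/(fcoef (moment 0 _) n) (big_morph _ moment0M moment0_1).
congr (fcoef _ n); apply: eq_bigr => j _.
rewrite (raddfB (@moment R 0)) /= moment0_1 moment0M; congr (1 - _ * _).
elim: j.-1 => [|k IHk]; first by rewrite !expr0 moment0_1.
by rewrite !exprS moment0M IHk moment0_X.
Qed.

End MomentZero.

(** * Moments of the logarithmic derivative as divisor sums *)

Lemma big_divisorsE (V : nmodType) (F : nat -> V) n N : (0 < n < N)%N ->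
  \sum_(1 <= j < N | (j %| n)%N) F (n %/ j)%N = \sum_(d <- divisors n) F d.
Proof.
(* Reindexing by the involution j -> n / j on the divisors of n; [n < N] keeps all of them in
   range. *)
case/andP=> n0 ltnN; rewrite -big_filter -(big_map (fun j => n %/ j)%N predT).
apply: perm_big; apply: uniq_perm; rewrite ?divisors_uniq //.
  rewrite map_inj_in_uniq ?filter_uniq ?iota_uniq // => i j.
  rewrite !mem_filter => /andP [idn _] /andP [jdn _] E.
  by rewrite -[i](mulKn _ n0) -[j](mulKn _ n0) -!divnA // E.
move=> d; rewrite -dvdn_divisors //; apply/mapP/idP => [[j]|dn].
  by rewrite mem_filter => /andP [/dvdn_div ? _] ->.
exists (n %/ d)%N; last by rewrite divnA // mulKn.
rewrite mem_filter dvdn_div // mem_index_iota divn_gt0 ?(dvdn_gt0 n0) //.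
by rewrite dvdn_leq // (leq_ltn_trans (leq_div _ _)).
Qed.

Lemma fcoef_moment_dlog (R : comNzRingType) (e : int) k n :
  fcoef (moment k (dlog_qpoch R e)) n =
  if n == 0%N then 0 else - e%:~R ^+ k.+1 * (sigma k n)%:R.
Proof.
rewrite [LHS]/= fcoef_sum raddf_sum /=.
case: posnP => [->|n0]; first by rewrite big1 // => j _; rewrite raddf0.
rewrite rmorph_sum /= mulr_sumr.
pose G d : R := - e%:~R ^+ k.+1 * (d ^ k)%:R.
have nS : (0 < n < n.+2)%N by rewrite n0 ltnW.
transitivity (\sum_(1 <= j < n.+2 | (j %| n)%N) G (n %/ j)%N); last first.
  exact: big_divisorsE.
rewrite [RHS]big_mkcond.
apply: eq_bigr => j _; case: ifP => _; last by rewrite raddf0.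
rewrite raddfMz /= laurent_momentU mulr1 rmorphM exprMn /G natrX exprS.
by rewrite -mulrzr rmorphN /= mulrN mulrC mulrA mulNr.
Qed.

(** The series L: the two denominators of the crank function enter with a minus sign, and the
    numerator is free of zeta. *)
Local Notation crank_dlog := (- (dlog_qpoch rat 1 + dlog_qpoch rat (-1))).

(** The factors zeta and zeta^-1 contribute 1 and (-1)^(k+1) times the divisor sum, which add up for
    k odd and cancel for k even. *)
Lemma fcoef_moment_crank_dlog k n :
  fcoef (moment k crank_dlog) n =
  if n == 0%N then 0 else (odd k)%:R * 2 * (sigma k n)%:R.
Proof.
rewrite (raddfN (@moment rat k)) (raddfD (@moment rat k)).
rewrite -[LHS]/(- (fcoef (moment _ _) n + fcoef (moment _ _) n)).
rewrite !fcoef_moment_dlog rmorphN1 -signr_odd expr1n /=.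
case: eqP => _; first by rewrite addr0 oppr0.
by case: (odd k); rewrite -mulrDl -mulNr.
Qed.

Lemma moment_crank_dlog_even k : ~~ odd k -> moment k crank_dlog = 0.
Proof.
move=> k_even; apply/fpsP => n; rewrite fcoef_moment_crank_dlog (negPf k_even).
by rewrite !mul0r if_same.
Qed.

(** The index is 2(k+1) - 1, the divisor power in G_(2k+2), whose constant term is subtracted. *)
Lemma moment_crank_dlog_odd k :
  moment k.*2.+1 crank_dlog =
  2 *: (eisenstein k.+1 - (- bernoulli (2 * k.+1) / (4 * k.+1)%:R) *: 1).
Proof.
rewrite /eisenstein mul2n doubleS; apply/fpsP => n.
rewrite fcoef_moment_crank_dlog /= odd_double mul1r.
case: eqP => _; first by rewrite mulr1 subrr mulr0.
by rewrite mulr0 subr0.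
Qed.

(** * Recurrence for the normalized crank moments *)

Lemma theta_crank : theta crank_gf = crank_gf * crank_dlog.
Proof.
have C0 (m : int) :
    fcoef (fps_const (zeta_pow m) * fps_X (laurent rat)) 0 = 0.
  by rewrite fcoef_constM mulr0.
have theta_Q : theta (qpoch (fps_X (laurent rat))) = 0.
  (* The case e = 0 is the product over q itself; the weight [- e] then kills its logarithmic
     derivative. *)
  have := theta_qpoch rat 0; rewrite [fps_const _ * _]mul1r => ->.
  rewrite (_ : dlog_qpoch rat 0 = 0) ?mulr0 //; apply/fpsP => n.
  by rewrite /= fcoef_sum big1 // => j _ /=; rewrite oppr0 mulr0z if_same.
rewrite /crank_gf.
have := theta_qpoch rat 1; have := theta_qpoch rat (-1).
have := fcoef_qpoch0 (C0 1); have := fcoef_qpoch0 (C0 (-1)).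
move: theta_Q.
set Q := qpoch (fps_X _); set A := qpoch (fps_const (zeta_pow 1) * _).
set B := qpoch _; move: (dlog_qpoch rat 1) (dlog_qpoch rat (-1)) => L1 L2.
move: Q A B => Q A B theta_Q B0 A0 theta_B theta_A.
have AB_unit : A * B \is a GRing.unit.
  by rewrite unitrM !fps_coef0_unit.
have := divrK AB_unit Q; move: (Q / _) => C CAB.
apply: (mulIr AB_unit).
(* Applying theta to [C * (A * B) = Q] avoids differentiating an inverse. *)
have : theta (C * (A * B)) = 0 by rewrite CAB.
rewrite !thetaM theta_A theta_B => /eqP; rewrite addr_eq0 => /eqP ->.
have -> : A * L1 * B + A * (B * L2) = (L1 + L2) * (A * B).
  by rewrite mulrDl mulrAC mulrA [L1 * _]mulrC [L2 * _]mulrC.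
by rewrite mulrN mulNr mulrA.
Qed.

Lemma normalized_crank_momentE k :
  normalized_crank_moment k = euler_q * moment k crank_gf.
Proof. by []. Qed.

(** At zeta = 1 the crank function becomes (q)_oo / (q)_oo^2, the inverse of the normalizing
    factor. *)
Lemma normalized_crank_moment0 : normalized_crank_moment 0 = 1.
Proof.
have E_unit : euler_q \is a GRing.unit.
  by rewrite fps_coef0_unit // /euler_q fcoef_qpoch0.
have AB_unit : qpoch (fps_const (zeta_pow 1) * fps_X (laurent rat)) *
    qpoch (fps_const (zeta_pow (-1)) * fps_X (laurent rat)) \is a GRing.unit.
  by rewrite unitrM !fps_coef0_unit // fcoef_qpoch0 // fcoef_constM mulr0.
rewrite normalized_crank_momentE; apply: (mulIr E_unit).
have : crank_gf * (qpoch (fps_const (zeta_pow 1) * fps_X (laurent rat)) *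
    qpoch (fps_const (zeta_pow (-1)) * fps_X (laurent rat))) =
    qpoch (fps_X (laurent rat)) by exact: divrK.
move: crank_gf => C /(congr1 (moment 0)).
rewrite !moment0M !moment0_qpoch !moment0M !moment0_const_zeta !moment0_X.
by rewrite !mul1r -/euler_q => E; rewrite -[RHS]E mulrA [euler_q * _]mulrC.
Qed.

Lemma normalized_crank_momentS m :
  normalized_crank_moment m.+1 =
  \sum_(i < m.+1) normalized_crank_moment i *
     moment (m - i) crank_dlog *+ 'C(m, i).
Proof.
rewrite normalized_crank_momentE -moment_theta theta_crank momentM mulr_sumr.
by apply: eq_bigr => i _; rewrite normalized_crank_momentE mulrnAr mulrA.
Qed.

(** * Solving the recurrence inside a subalgebra *)

Section SubalgebraRecurrence.
Variables (F : fieldType) (A : algType F) (B : set A).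
Hypothesis B_closed : GRing.subalg_closed (mem B).

Let B1 : B 1. Proof. by case: B_closed => /asboolP. Qed.
Let BM x y : B x -> B y -> B (x * y).
Proof. by case: B_closed => _ _ BM Bx By; apply/asboolP/BM; apply/asboolP. Qed.
Let BL a x y : B x -> B y -> B (a *: x + y).
Proof. by case: B_closed => _ BL _ Bx By; apply/asboolP/BL; apply/asboolP. Qed.
Let B0 : B 0.
Proof. by have := BL (-1) B1 B1; rewrite scaleN1r addNr. Qed.
Let BD x y : B x -> B y -> B (x + y).
Proof. by rewrite -{2}[x]scale1r; apply: BL. Qed.
Let BZ a x : B x -> B (a *: x).
Proof. by move=> Bx; rewrite -[_ *: _]addr0; apply: BL. Qed.
Let B_sum n (G : 'I_n -> A) : (forall i, B (G i)) -> B (\sum_(i < n) G i).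
Proof. by move=> BG; elim/big_ind: _ => // x y; apply: BD. Qed.
Let BMn x n : B x -> B (x *+ n).
Proof. by rewrite -scaler_nat; apply: BZ. Qed.

(** Used to pass between G_(2k) and twice its part without constant term. *)
Lemma subalg_affine (a b : F) (x : A) :
  a != 0 -> B (a *: (x - b *: 1)) <-> B x.
Proof.
move=> a0; split=> Bx; last first.
  by apply/BZ/BD => //; rewrite -scaleNr; apply: BZ.
have -> : x = a^-1 *: (a *: (x - b *: 1)) + b *: 1.
  by rewrite scalerA mulVf // scale1r subrK.
by apply: BL => //; apply: BZ.
Qed.

Variables c l : nat -> A.
Hypothesis c0 : c 0 = 1.
Hypothesis cS : forall m,
  c m.+1 = \sum_(i < m.+1) c i * l (m - i)%N *+ 'C(m, i).
Hypothesis l_even : forall k, ~~ odd k -> l k = 0.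

Lemma subalg_moments_of_dlog :
  (forall k, B (l k)) -> forall k, B (c k).
Proof.
move=> Bl; elim/ltn_ind=> -[|m] IHm; first by rewrite c0.
by rewrite cS; apply: B_sum => i; apply/BMn/BM => //; apply: IHm.
Qed.

(* The term i = 0 of the recurrence is l m; a term with c i for i odd vanishes
   when m is odd, since then m - i is even. *)
Lemma subalg_dlog_of_even_moments :
  (forall k, ~~ odd k -> B (c k)) -> forall k, B (l k).
Proof.
move=> Bc; elim/ltn_ind=> m IHm.
have [m_odd|/l_even ->//] := boolP (odd m).
have := cS m; rewrite big_ord_recl c0 mul1r subn0 bin0 mulr1n => /eqP.
rewrite -subr_eq => /eqP <-.
(* As m is odd, [c m.+1] has even index. *)
apply: BD; first by apply: Bc; rewrite /= m_odd.
rewrite -scaleN1r; apply/BZ/B_sum => i; apply: BMn.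
have [i_odd|i_even] := boolP (odd (lift ord0 i)).
  rewrite l_even ?mulr0 // oddB ?m_odd ?i_odd //.
  by rewrite lift0 ltn_ord.
apply: BM; first exact: Bc.
by apply: IHm; rewrite lift0 ltn_subrL ?(leq_ltn_trans _ (ltn_ord i)).
Qed.

End SubalgebraRecurrence.

(** * Equality of the generated algebras *)

Lemma subalg_crank_iff_eisenstein (B : set (fps rat)) :
  GRing.subalg_closed (mem B) ->
  (forall k, (1 <= k)%N -> B (normalized_crank_moment (2 * k))) <->
  (forall k, (1 <= k)%N -> B (eisenstein k)).
Proof.
move=> B_closed.
have lE k : B (moment k.*2.+1 crank_dlog) <-> B (eisenstein k.+1).
  by rewrite moment_crank_dlog_odd subalg_affine.
have B0 : B 0.
  case: B_closed => /asboolP B1 BL _.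
  have /asboolP := BL (-1) 1 1 (asboolT B1) (asboolT B1).
  by rewrite scaleN1r addNr.
split=> [Bc [//|k] _|BE].
  apply/lE; apply: (subalg_dlog_of_even_moments B_closed
    normalized_crank_moment0 normalized_crank_momentS
    moment_crank_dlog_even) => i.
  (* The generators start at k = 1, so index 0 is settled separately by c_0 = 1. *)
  rewrite -dvdn2 => /dvdnP [[|j] ->].
    by rewrite mul0n normalized_crank_moment0; case: B_closed => /asboolP.
  by rewrite mulnC; apply: Bc.
move=> k _; apply: (subalg_moments_of_dlog
  (l := fun i => moment i crank_dlog) B_closed
  normalized_crank_moment0 normalized_crank_momentS) => i.
have [i_odd|/moment_crank_dlog_even ->//] := boolP (odd i).
rewrite -(odd_double_half i) i_odd; apply/lE; exact: BE.
Qed.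

Theorem mainTheorem5 :
  generated_subalg
    [set normalized_crank_moment (2 * k) | k in [set k | (1 <= k)%N]]
  = generated_subalg [set eisenstein k | k in [set k | (1 <= k)%N]].
Proof.
(* Each generated algebra is the intersection of the subalgebras containing its family, and both
   families lie in the same subalgebras. *)
apply/seteqP; split=> x x_gen B B_closed SB; apply: x_gen => // _ [k /= k1 <-].
  apply: (subalg_crank_iff_eisenstein B_closed).2 => // j j1.
  by apply: SB; exists j.
apply: (subalg_crank_iff_eisenstein B_closed).1 => // j j1.
by apply: SB; exists j.
Qed.
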